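(* Let $\Gamma$ be a finite abelian host group of a connected graph $G$, with isometric embedding $\phi:V(G)\to\Gamma$ into a Cayley graph of $\Gamma$, and let $\hat\psi_0,\dots,\hat\psi_J$ be a normalized filter bank with associated wavelets $\psi_{j,h}$. The family $\{\psi_{j,h}:0\leq j\leq J,\ h\in\Gamma\}$ is a Parseval tight frame for $\mathbb{C}^{\Gamma}$: for every $\tilde s\in\mathbb{C}^\Gamma$, $$\sum_{j=0}^{J}\sum_{h\in\Gamma}|\langle\tilde s,\psi_{j,h}\rangle|^2=\|\tilde s\|_2^2,\qquad \tilde s=\sum_{j=0}^{J}\sum_{h\in\Gamma}\langle\tilde s,\psi_{j,h}\rangle\,\psi_{j,h}.$$ Consequently any graph signal $s:V(G)\to\mathbb{C}$ is reconstructed exactly from its wavelet coefficients $W_s(j,h)=\langle\mathcal{L}s,\psi_{j,h}\rangle$ via $s=\mathcal{R}\bigl(\sum_{j,h}W_s(j,h)\psi_{j,h}\bigr)$.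
   Context: $\Gamma=\mathbb{Z}_{N_1}\times\cdots\times\mathbb{Z}_{N_d}$, $N=|\Gamma|$, with characters $\chi_k(g)=\prod_j e^{2\pi i k_jg_j/N_j}$, $k\in\Gamma$. The inner product on $\mathbb{C}^\Gamma$ is $\langle f,h\rangle=\sum_{g\in\Gamma}f(g)\overline{h(g)}$. The Fourier transform on $\Gamma$ is $\mathcal{F}f(k)=\hat f(k)=\frac{1}{\sqrt N}\sum_{g\in\Gamma}f(g)\overline{\chi_k(g)}$, with inverse $\mathcal{F}^{-1}F(g)=\frac{1}{\sqrt N}\sum_kF(k)\chi_k(g)$. Translation by $h\in\Gamma$: $\tau_h f(g)=f(g-h)$. The lift $\mathcal{L}s\in\mathbb{C}^\Gamma$ of a signal $s$ on $V(G)$ equals $s(v)$ at $\phi(v)$ and $0$ off $\phi(V(G))$; the restriction is $(\mathcal{R}f)(v)=f(\phi(v))$. Let $|k|$ denote the frequency magnitude of the character $\chi_k$ (e.g. $|k|=(\sum_i\min(k_i,N_i-k_i)^2)^{1/2}$) and $|k|_{\max}=\max_k|k|$. Normalized filter bank: for $J\ge1$, fix band-pass kernels $g_1,\dots,g_J:[0,|k|_{\max}]\to[0,\infty)$ and one low-pass scaling kernel $g_0$, and put $\hat\psi_j(k)=g_j(|k|)/\sqrt{\sum_{i=0}^{J}g_i(|k|)^2}$ for $j=0,\dots,J$, so that $\sum_{j=0}^J|\hat\psi_j(k)|^2=1$ for every $k$. The wavelet at scale $j$ centered at $h\in\Gamma$ is $\psi_{j,h}=\tau_h\mathcal{F}^{-1}\hat\psi_j$,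 i.e. $\hat\psi_{j,h}(k)=\overline{\chi_k(h)}\,\hat\psi_j(k)$.
   Formalization: As normalized, the wavelets form a tight frame with bound N, not 1; this is proved with the factor N, and the Parseval identities and signal reconstruction are proved for the wavelets rescaled by N^{-1/2}. The normalizing denominators are assumed nonzero. *)

(* Defs.v *)
From HB Require Import structures.
From mathcomp Require Import all_boot all_order all_algebra.
From mathcomp Require Import reals trigo.
From mathcomp Require Import complex.

Set Implicit Arguments.
Unset Strict Implicit.
Unset Printing Implicit Defensive.

Import Order.TTheory GRing.Theory Num.Theory.
Local Open Scope ring_scope.

(* The product of the cyclic groups Z_{N_j}, j < d, where N_j = (m j).+1, so
   that every N_j >= 1 is covered and 'I_(m j).+1 is the group Z_{N_j}. *)
Definition prod_cyclic (d : nat) (m : 'I_d -> nat) :=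
  {dffun forall j : 'I_d, 'I_(m j).+1}.

Section ProdCyclicGroup.
Variables (d : nat) (m : 'I_d -> nat).
Local Notation Gam := (prod_cyclic m).

HB.instance Definition _ := Finite.on Gam.

Definition prod_cyclic_zero : Gam := [ffun j : 'I_d => (0 : 'I_(m j).+1)].
Definition prod_cyclic_opp (x : Gam) : Gam :=
  [ffun j : 'I_d => - (x j : 'I_(m j).+1)].
Definition prod_cyclic_add (x y : Gam) : Gam :=
  [ffun j : 'I_d => (x j : 'I_(m j).+1) + y j].

Fact prod_cyclic_addA : associative prod_cyclic_add.
Proof. by move=> x y z; apply/ffunP => j; rewrite !ffunE addrA. Qed.
Fact prod_cyclic_addC : commutative prod_cyclic_add.
Proof. by move=> x y; apply/ffunP => j; rewrite !ffunE addrC. Qed.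
Fact prod_cyclic_add0 : left_id prod_cyclic_zero prod_cyclic_add.
Proof. by move=> x; apply/ffunP => j; rewrite !ffunE add0r. Qed.
Fact prod_cyclic_addN :
  left_inverse prod_cyclic_zero prod_cyclic_opp prod_cyclic_add.
Proof. by move=> x; apply/ffunP => j; rewrite !ffunE addNr. Qed.

HB.instance Definition _ := GRing.isZmodule.Build Gam
  prod_cyclic_addA prod_cyclic_addC prod_cyclic_add0 prod_cyclic_addN.

End ProdCyclicGroup.

Section Graphs.
Variable T : finType.
Implicit Types (e : rel T) (x y : T).

Definition simple_graph e := symmetric e /\ irreflexive e.

Definition connected_graph e := forall x y, connect e x y.

(* The number of edges of a shortest walk from x to y. The value is #|T|,
   which exceeds every finite distance, when there is no such walk. *)
Definition graph_dist e x y : nat :=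
  find (fun n => [exists p : n.-tuple T, path e x p && (last x p == y)])
       (iota 0 #|T|).

End Graphs.

Definition isometric_embedding (T U : finType) (e : rel T) (e' : rel U)
    (phi : T -> U) :=
  forall x y, graph_dist e' (phi x) (phi y) = graph_dist e x y.

Section Cayley.
Variables (d : nat) (m : 'I_d -> nat).
Local Notation Gam := (prod_cyclic m).

Definition connection_set (S : {set Gam}) :=
  0 \notin S /\ (forall x, x \in S -> - x \in S).

Definition cayley (S : {set Gam}) : rel Gam := fun x y => y - x \in S.

End Cayley.

Section Fourier.
Variables (R : realType) (d : nat) (m : 'I_d -> nat).
Local Notation Gam := (prod_cyclic m).
Local Notation C := R[i].

(* e^{i t} *)
Definition expi (t : R) : C := (cos t +i* sin t)%C.

Definition char (k g : Gam) : C :=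
  \prod_(j < d) expi (2 * pi * (k j)%:R * (g j)%:R / (m j).+1%:R).

Definition inner (f h : {ffun Gam -> C}) : C := \sum_g f g * (h g)^*.

Definition norm2 (f : {ffun Gam -> C}) : C := sqrtC (\sum_g `|f g| ^+ 2).

(* Inverse of the unitary transform f |-> N^{-1/2} \sum_g f g * (char k g)^*. *)
Definition inv_fourier (F : {ffun Gam -> C}) : {ffun Gam -> C} :=
  [ffun g => (sqrtC #|{: Gam}|%:R)^-1 * \sum_k F k * char k g].

Definition translate (h : Gam) (f : {ffun Gam -> C}) : {ffun Gam -> C} :=
  [ffun g => f (g - h)].

(* The standard example of a frequency magnitude. *)
Definition euclidean_magnitude (k : Gam) : R :=
  Num.sqrt (\sum_(j < d) (minn (k j) ((m j).+1 - k j))%:R ^+ 2).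

Lemma euclidean_magnitude_ge0 k : 0 <= euclidean_magnitude k.
Proof. exact: sqrtr_ge0. Qed.

Definition magnitude_max (mag : Gam -> R) : R := \big[Num.max/0]_k mag k.

Section FilterBank.
(* mag k plays the role of |k|; g 0 is the scaling kernel. Kernels are total
   functions, used only on [0, magnitude_max mag]. *)
Variables (mag : Gam -> R) (J : nat) (g : 'I_J.+1 -> R -> R).

Definition kernels_nonneg :=
  forall j x, 0 <= x <= magnitude_max mag -> 0 <= g j x.

(* The normalizing denominators do not vanish. *)
Definition normalizable := forall k, \sum_(i < J.+1) g i (mag k) ^+ 2 != 0.

Definition filter_hat (j : 'I_J.+1) : {ffun Gam -> C} :=
  [ffun k => (g j (mag k) /
              Num.sqrt (\sum_(i < J.+1) g i (mag k) ^+ 2))%:C%C].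

Definition wavelet (j : 'I_J.+1) (h : Gam) : {ffun Gam -> C} :=
  translate h (inv_fourier (filter_hat j)).

(* As \sum_j |filter_hat j k|^2 = 1 and inv_fourier is unitary, [wavelet] is a
   tight frame with bound N = #|Gam|, which is not 1 unless the group is
   trivial; the factor N^{-1/2} makes it a Parseval frame. *)
Definition parseval_wavelet (j : 'I_J.+1) (h : Gam) : {ffun Gam -> C} :=
  (sqrtC #|{: Gam}|%:R)^-1 *: wavelet j h.

End FilterBank.

Section Signals.
Variables (V : finType) (phi : V -> Gam).

(* For injective phi, the vertex picked at phi v is v. *)
Definition lift_signal (s : {ffun V -> C}) : {ffun Gam -> C} :=
  [ffun x => if [pick v | phi v == x] is Some v then s v else 0].

Definition restrict_signal (f : {ffun Gam -> C}) : {ffun V -> C} :=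
  [ffun v => f (phi v)].

End Signals.

End Fourier.

(* Main.v *)
(* Writing each wavelet as a combination of characters and summing over the
   translations h, orthogonality of characters leaves
     sum_h conj (psi_{j,h} x) * psi_{j,h} y
       = sum_k |filter_hat j k|^2 * chi_k (y - x).
   Summing over j removes the filters, since their squared moduli add up to 1,
   and orthogonality once more gives N times the Kronecker delta of x and y.
   The frame operator is thus N times the identity; pairing it with f gives the
   energy identity. An isometric embedding is injective, hence a signal is
   recovered by restricting its lift. *)
Require Import Defs.
From HB Require Import structures.
From mathcomp Require Import all_boot all_order all_algebra.
From mathcomp Require Import reals trigo.
From mathcomp Require Import complex.
From mathcomp Require Import ring lra.

Set Implicit Arguments.
Unset Strict Implicit.
Unset Printing Implicit Defensive.

Import Order.TTheory GRing.Theory Num.Theory.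
Local Open Scope ring_scope.

(* Over [R[i]], simplifying after [rmorphM] or [rmorph_sum] replaces [Num.conj]
   by [conjc], which blocks the lemmas on [Num.conj]. *)
Lemma conjCM (C : numClosedFieldType) (x y : C) : (x * y)^* = x^* * y^*.
Proof. exact: rmorphM. Qed.

Lemma conjC_sum (C : numClosedFieldType) (I : finType) (F : I -> C) :
  (\sum_i F i)^* = \sum_i (F i)^*.
Proof. exact: rmorph_sum. Qed.

(** * Characters of a product of cyclic groups and their orthogonality *)

Section Characters.
Variable R : realType.
Local Notation C := R[i].
Implicit Types (a b t : R).

Lemma expiD a b : expi (a + b) = expi a * expi b.
Proof. by rewrite /expi cosD sinD; simpc; rewrite [X in (_ +i* X)%C]addrC. Qed.

Lemma expi0 : expi (0 : R) = 1.
Proof. by rewrite /expi cos0 sin0. Qed.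

Lemma expiMn a n : expi (a *+ n) = expi a ^+ n.
Proof.
elim: n => [|n IHn]; first by rewrite mulr0n expi0 expr0.
by rewrite mulrS expiD IHn exprS.
Qed.

Lemma expi_2pi : expi (2 * pi : R) = 1.
Proof. by rewrite /expi mulr_natl cos2pi sin2pi. Qed.

Lemma normr_expi a : `|expi a| = 1.
Proof. by rewrite normc_def /= cos2Dsin2 sqrtr1. Qed.

(** The real part is [1 - 2 sin(t/2)^2], and sine is positive on the open interval from 0 to
    [pi]. *)
Lemma expi_neq1 t : 0 < t < 2 * pi -> expi t != 1.
Proof.
move=> /andP[t_gt0 t_lt]; apply/eqP => /(congr1 (@complex.Re R)) /=.
have {1}-> : t = (t / 2) *+ 2 by rewrite -mulr_natr divfK ?pnatr_eq0.
have sin_gt0 : 0 < sin (t / 2).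
  by apply: sin_gt0_pi; rewrite divr_gt0 //= ltr_pdivrMr // mulrC.
rewrite cos_mulr2n cos2sin2 => /eqP.
have := exprn_gt0 2 sin_gt0; lra.
Qed.

(** A primitive root of unity of order [n.+1]; the shift matches ['I_n.+1]. *)
Definition unity_root (n : nat) : C := expi (2 * pi / n.+1%:R).

Lemma unity_rootX n : unity_root n ^+ n.+1 = 1.
Proof. by rewrite -expiMn -[_ *+ n.+1]mulr_natr divfK ?pnatr_eq0 // expi_2pi. Qed.

Lemma unity_rootX_neq1 n i : (0 < i < n.+1)%N -> unity_root n ^+ i != 1.
Proof.
move=> /andP[i_gt0 i_lt]; rewrite -expiMn; apply: expi_neq1.
rewrite -[_ *+ i]mulr_natr mulrAC -mulrA.
have pi2_gt0 : 0 < 2 * pi :> R by rewrite mulr_gt0 ?pi_gt0.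
rewrite mulr_gt0 ?divr_gt0 ?ltr0n //=.
by rewrite gtr_pMr // ltr_pdivrMr ?ltr0n // mul1r ltr_nat.
Qed.

Variables (d : nat) (m : 'I_d -> nat).
Local Notation Gam := (prod_cyclic m).
Implicit Types (k l x y h : Gam).

(** Natural exponents of a root of unity absorb the reduction modulo [(m j).+1] hidden in the group
    law. *)
Lemma charE k x : char R k x = \prod_(j < d) unity_root (m j) ^+ (k j * x j).
Proof.
apply: eq_bigr => j _; rewrite -expiMn -[_ *+ (_ * _)]mulr_natr natrM.
by congr expi; ring.
Qed.

Lemma charC k x : char R k x = char R x k.
Proof. by rewrite !charE; apply: eq_bigr => j _; rewrite mulnC. Qed.

Lemma charDl k l x : char R (k + l) x = char R k x * char R l x.
Proof.
rewrite !charE -big_split; apply: eq_bigr => j _ /=.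
rewrite ffunE /= -exprD -mulnDl exprM expr_mod ?unity_rootX //.
by rewrite -exprM.
Qed.

Lemma char0l x : char R 0 x = 1.
Proof. by rewrite charE big1 // => j _; rewrite ffunE mul0n expr0. Qed.

(** Character values have modulus 1, so conjugate and inverse agree. *)
Lemma char_conj k x : (char R k x)^* = char R (- k) x.
Proof.
have normk : `|char R k x| = 1.
  by rewrite normr_prod big1 // => j _; rewrite normr_expi.
have char_neq0 : char R k x != 0 by rewrite -normr_eq0 normk oner_eq0.
apply: (mulfI char_neq0).
by rewrite -normCK normk expr1n -charDl subrr char0l.
Qed.

Lemma charDr k x y : char R k (x + y) = char R k x * char R k y.
Proof. by rewrite !(charC k) charDl. Qed.

Lemma charNr k x : char R k (- x) = (char R k x)^*.
Proof. by rewrite (charC k x) char_conj charC. Qed.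

Lemma char_nontrivial x : x != 0 -> exists k, char R k x != 1.
Proof.
move=> x_neq0.
have [j xj_neq0] : exists j, x j != 0 :> 'I__.
  apply/existsP; apply: contraNT x_neq0; rewrite negb_exists => /forallP x0.
  by apply/eqP/ffunP => j; rewrite ffunE; apply/eqP/negPn/x0.
have xj_gt0 : (0 < x j)%N by rewrite lt0n.
(* This makes 1 a valid element of ['I_(m j).+1], as [inord] below requires. *)
have mj_gt0 : (0 < m j)%N by rewrite -ltnS (leq_ltn_trans xj_gt0).
(* The [j]-th unit vector: its character at [x] is [unity_root (m j) ^+ x j]. *)
exists [ffun i => inord (i == j)]; rewrite charE (bigD1 j) //= big1 => [|i].
  by rewrite ffunE inordK ?eqxx // mul1n mulr1 unity_rootX_neq1 ?xj_gt0 /=.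
by move=> /negPf i_neqj; rewrite ffunE i_neqj inordK.
Qed.

(* Multiplication by a character value other than 1 permutes the summands. *)
Lemma sum_char x : \sum_k char R k x = #|{: Gam}|%:R *+ (x == 0).
Proof.
case: eqVneq => [->|/char_nontrivial[l l_neq1]].
  by rewrite (eq_bigr (fun=> 1)) ?sumr_const // => k _; rewrite charC char0l.
rewrite mulr0n; apply/eqP; move: l_neq1; apply: contraNT => sum_neq0.
rewrite -subr_eq0; apply/eqP/(mulIf sum_neq0).
rewrite mul0r mulrBl mul1r; apply/eqP; rewrite subr_eq0 mulr_sumr; apply/eqP.
rewrite [RHS](reindex_inj (addrI l)) /=.
by apply: eq_bigr => k _; rewrite charDl.
Qed.

End Characters.

(** * Frame kernels of translated filters *)

Section Frame.
Variables (R : realType) (d : nat) (m : 'I_d -> nat).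
Local Notation Gam := (prod_cyclic m).
Local Notation C := R[i].
Local Notation N := (#|{: Gam}|%:R : C).
Implicit Types (f u v : {ffun Gam -> C}).

Lemma card_prod_cyclic_neq0 : N != 0.
Proof. by rewrite pnatr_eq0 -lt0n; apply/card_gt0P; exists 0. Qed.

Lemma conj_inv_sqrt_card : ((sqrtC N)^-1)^* * (sqrtC N)^-1 = N^-1.
Proof. by rewrite -normCKC normfV exprVn ger0_norm ?sqrtCK ?sqrtC_ge0. Qed.

Lemma inner_sumZl (I : finType) (c : I -> C) (u : I -> {ffun Gam -> C}) v :
  inner (\sum_i c i *: u i) v = \sum_i c i * inner (u i) v.
Proof.
rewrite /inner; under [RHS]eq_bigr do rewrite mulr_sumr.
rewrite exchange_big; apply: eq_bigr => x _ /=.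
by rewrite sum_ffunE mulr_suml; apply: eq_bigr => i _; rewrite ffunE mulrA.
Qed.

Lemma inner_conj u v : (inner u v)^* = inner v u.
Proof.
rewrite /inner conjC_sum; apply: eq_bigr => x _ /=.
by rewrite conjCM conjCK mulrC.
Qed.

Lemma norm2_sqr f : norm2 f ^+ 2 = inner f f.
Proof.
by rewrite /norm2 sqrtCK; apply: eq_bigr => x _; rewrite -normCK.
Qed.

Section TightFrame.
Variables (I J : finType) (A : C) (psi : I -> J -> {ffun Gam -> C}).

(** At [y], the coefficient of [f x] in the expansion is the frame kernel at [(x, y)]. *)
Lemma frame_reconstruction f :
  (forall x y, \sum_i \sum_j (psi i j x)^* * psi i j y = A *+ (x == y)) ->
  \sum_i \sum_j inner f (psi i j) *: psi i j = A *: f.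
Proof.
move=> kernelE; apply/ffunP => y; rewrite [RHS]ffunE.
transitivity (\sum_x f x * \sum_i \sum_j (psi i j x)^* * psi i j y).
  rewrite sum_ffunE; under [RHS]eq_bigr do rewrite mulr_sumr.
  rewrite [RHS]exchange_big; apply: eq_bigr => i _.
  rewrite sum_ffunE /=; under [RHS]eq_bigr do rewrite mulr_sumr.
  rewrite [RHS]exchange_big; apply: eq_bigr => j _.
  rewrite ffunE /inner /GRing.scale /= mulr_suml.
  by apply: eq_bigr => x _; rewrite mulrA.
rewrite (bigD1 y) //= kernelE eqxx big1 ?addr0; first by rewrite mulrC.
by move=> x /negPf xy; rewrite kernelE xy mulr0.
Qed.

(** Pairing the expansion with [f] multiplies each coefficient by its own conjugate. *)
Lemma frame_energy f :
  \sum_i \sum_j inner f (psi i j) *: psi i j = A *: f ->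
  \sum_i \sum_j `|inner f (psi i j)| ^+ 2 = A * norm2 f ^+ 2.
Proof.
move=> reconstruct; rewrite norm2_sqr.
transitivity (inner (A *: f) f).
  rewrite -reconstruct !pair_bigA inner_sumZl /=.
  by apply: eq_bigr => -[i j] _ /=; rewrite normCK inner_conj.
rewrite /inner mulr_sumr.
by apply: eq_bigr => x _; rewrite ffunE mulrA.
Qed.

End TightFrame.

Lemma translate_gram (F : {ffun Gam -> C}) x y :
  \sum_h (translate h (inv_fourier F) x)^* * translate h (inv_fourier F) y
  = \sum_k `|F k| ^+ 2 * char R k (y - x).
Proof.
(* The two normalizing factors give [N^-1], and [h] enters only through the character of [k - l]. *)
transitivity (\sum_h N^-1 * \sum_k \sum_l
    ((F k)^* * F l * ((char R k x)^* * char R l y)) * char R (k - l) h).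
  apply: eq_bigr => h _; rewrite !ffunE conjCM mulrACA conj_inv_sqrt_card; congr (_ * _).
  rewrite conjC_sum mulr_suml; apply: eq_bigr => k _.
  rewrite mulr_sumr; apply: eq_bigr => l _.
  rewrite !charDr !charNr !conjCM conjCK charDl -char_conj; ring.
rewrite -mulr_sumr exchange_big /= mulr_sumr; apply: eq_bigr => k _.
(* Summing over [h] gives [N] for [l = k], cancelling [N^-1], and 0 otherwise. *)
rewrite exchange_big /= (bigD1 k) //= [X in _ + X]big1 => [|l l_neqk].
  rewrite -mulr_sumr subrr addr0.
  under eq_bigr do rewrite char0l.
  rewrite sumr_const mulrC mulfK ?card_prod_cyclic_neq0 //.
  by rewrite normCK charDr charNr; ring.
rewrite -mulr_sumr; under eq_bigr do rewrite charC.
by rewrite sum_char subr_eq0 eq_sym (negPf l_neqk) mulr0.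
Qed.

Variables (mag : Gam -> R) (J : nat) (g : 'I_J.+1 -> R -> R).

Lemma filter_hat_sum : normalizable mag g ->
  forall k, \sum_j `|filter_hat mag g j k| ^+ 2 = 1.
Proof.
move=> gN k; have := gN k; set D := \sum_(i < _) _ => D_neq0.
have D_ge0 : 0 <= D by apply: sumr_ge0 => i _; rewrite sqr_ge0.
under eq_bigr => j _.
  rewrite ffunE -normrX -rmorphXn exprMn exprVn sqr_sqrtr //= ger0_norm.
    over.
  by rewrite lecR divr_ge0 ?sqr_ge0.
by rewrite -rmorph_sum -mulr_suml divff.
Qed.

Lemma wavelet_gram : normalizable mag g -> forall x y,
  \sum_j \sum_h (wavelet mag g j h x)^* * wavelet mag g j h y = N *+ (x == y).
Proof.
move=> gN x y; under eq_bigr do rewrite translate_gram.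
(* The Kronecker delta is expanded into the sum of all characters at [y - x], to be compared
   termwise. *)
rewrite exchange_big /= -[x == y]eq_sym -subr_eq0 -sum_char.
by apply: eq_bigr => k _; rewrite -mulr_suml filter_hat_sum // mul1r.
Qed.

Lemma parseval_wavelet_gram : normalizable mag g -> forall x y,
  \sum_j \sum_h (parseval_wavelet mag g j h x)^* * parseval_wavelet mag g j h y
  = 1 *+ (x == y).
Proof.
(* Multiplying by [N] undoes the two factors [N^{-1/2}] and leaves the kernel of [wavelet]. *)
move=> gN x y; apply: (mulfI card_prod_cyclic_neq0).
rewrite mulrnAr mulr1 -(wavelet_gram gN) mulr_sumr; apply: eq_bigr => j _.
rewrite mulr_sumr; apply: eq_bigr => h _.
rewrite ![parseval_wavelet _ _ _ _ _]ffunE conjCM mulrACA conj_inv_sqrt_card.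
by rewrite mulVKf ?card_prod_cyclic_neq0.
Qed.

End Frame.

Lemma graph_dist_eq0 (T : finType) (e : rel T) (x y : T) :
  (graph_dist e x y == 0%N) = (x == y).
Proof.
(* The vertex [x] rules out an empty [T], so length 0 is always tried first; a walk of length 0
   joins only equal vertices. *)
rewrite /graph_dist; case cardT : #|T| => [|n] /=.
  by move: (card0_eq cardT x); rewrite inE.
suff -> : [exists p : 0.-tuple T, path e x p && (last x p == y)] = (x == y).
  by case: (x == y).
apply/existsP/idP => [[p]|xy]; first by rewrite (tuple0 p).
by exists [tuple].
Qed.

(** Equal images are at distance 0, hence so are the original vertices. *)
Lemma isometric_embedding_inj (T U : finType) (e : rel T) (e' : rel U)
    (phi : T -> U) : isometric_embedding e e' phi -> injective phi.
Proof.
move=> phi_iso x y /eqP phi_xy; apply/eqP.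
by rewrite -(graph_dist_eq0 e) -phi_iso graph_dist_eq0.
Qed.

Lemma lift_signalK (R : realType) (d : nat) (m : 'I_d -> nat) (V : finType)
    (phi : V -> prod_cyclic m) : injective phi ->
  cancel (@lift_signal R d m V phi) (restrict_signal phi).
Proof.
move=> phi_inj s; apply/ffunP => v; rewrite !ffunE.
case: pickP => [w /eqP/phi_inj-> //|/(_ v)]; by rewrite eqxx.
Qed.

Theorem theorem6p7 (R : realType) (d : nat) (m : 'I_d -> nat)
    (V : finType) (e : rel V) (S : {set prod_cyclic m})
    (phi : V -> prod_cyclic m)
    (mag : prod_cyclic m -> R) (J : nat) (g : 'I_J.+1 -> R -> R) :
  simple_graph e -> connected_graph e ->
  connection_set S -> isometric_embedding e (cayley S) phi ->
  (forall k, 0 <= mag k) ->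
  (1 <= J)%N -> kernels_nonneg mag g -> normalizable mag g ->
  let N : R[i] := #|{: prod_cyclic m}|%:R in
  let psi := wavelet mag g in
  let psi1 := parseval_wavelet mag g in
  [/\ (forall f : {ffun prod_cyclic m -> R[i]},
        \sum_(j < J.+1) \sum_(h : prod_cyclic m) `|inner f (psi j h)| ^+ 2
        = N * norm2 f ^+ 2),
      (forall f : {ffun prod_cyclic m -> R[i]},
        N *: f = \sum_(j < J.+1) \sum_(h : prod_cyclic m)
                   inner f (psi j h) *: psi j h),
      (forall f : {ffun prod_cyclic m -> R[i]},
        \sum_(j < J.+1) \sum_(h : prod_cyclic m) `|inner f (psi1 j h)| ^+ 2
        = norm2 f ^+ 2),
      (forall f : {ffun prod_cyclic m -> R[i]},
        f = \sum_(j < J.+1) \sum_(h : prod_cyclic m)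
              inner f (psi1 j h) *: psi1 j h)
    & (forall s : {ffun V -> R[i]},
        s = restrict_signal phi
              (\sum_(j < J.+1) \sum_(h : prod_cyclic m)
                 inner (lift_signal phi s) (psi1 j h) *: psi1 j h))].
Proof.
move=> _ _ _ phi_iso _ _ _ gN N psi psi1.
have psiK f := frame_reconstruction f (wavelet_gram gN).
have psi1K f := frame_reconstruction f (parseval_wavelet_gram gN).
split=> [f|f|f|f|s].
- exact: frame_energy.
- by rewrite psiK.
- by rewrite (frame_energy (psi1K f)) mul1r.
- by rewrite psi1K scale1r.
- by rewrite psi1K scale1r lift_signalK //; apply: isometric_embedding_inj phi_iso.
Qed.
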